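(* Let $K$ be a field with algebraic closure $\overline{K}$, and let $G$ be a subgroup of $\overline{K}^\times$ consisting of radicals over $K$ such that the index $|GK^\times:K^\times|$ is finite. Let $n$ be the smallest positive integer with $G^n\subseteq K^\times$, and let $z$ be the product of the odd primes $p$ dividing $n$ such that $\zeta_p\notin K^\times$ and $\zeta_p\in GK^\times$ ($z=1$ if there is none). Then the degree $[K(G):K]$ divides $$\frac{1}{z}\cdot [K(\zeta_z):K]\cdot |GK^\times:K^\times|\,.$$
   Context: A radical over $K$ is an element $\alpha\in\overline{K}^\times$ such that $\alpha^m\in K^\times$ for some positive integer $m$ coprime to the characteristic of $K$. For every positive integer $m$ coprime to $\mathrm{char}(K)$, $\zeta_m\in\overline{K}^\times$ denotes a fixed primitive $m$-th root of unity, chosen coherently ($\zeta_M^{M/m}=\zeta_m$ when $m\mid M$). *)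

(* Defs.v *)
From HB Require Import structures.
From mathcomp Require Import all_boot all_order all_algebra.
From mathcomp Require Import finmap boolp classical_sets functions cardinality.

Set Implicit Arguments.
Unset Strict Implicit.
Unset Printing Implicit Defensive.

Import GRing.Theory.
Local Open Scope ring_scope.
Local Open Scope classical_set_scope.

Section MultiplicativeGroups.
Variable L : fieldType.
Implicit Types A B G H N : set L.

Definition mul_subgroup G :=
  G `<=` [set x | x != 0] /\ GRing.divr_closed [in G].

Definition set_mul A B : set L := [set x * y | x in A & y in B].

Definition cosets H N : set (set L) := [set [set h * a | a in N] | h in H].

(* [fset_set] is empty on infinite sets: this is |H : N| only when
   [finite_set (cosets H N)]. *)
Definition mul_index H N : nat := #|` fset_set (cosets H N)|.

End MultiplicativeGroups.

Section Extension.
Variables (K : fieldType) (L : fieldType) (iota : {rmorphism K -> L}).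

Definition base_units : set L := [set iota a | a in [set a : K | a != 0]].

(* [[pchar K]^'.-nat m] says that m > 0 and that no prime divisor of m is the
   characteristic; in characteristic 0 this is just m > 0. *)
Definition radical (x : L) :=
  x != 0 /\ exists2 m : nat, [pchar K]^'.-nat m & base_units (x ^+ m).

Definition coherent_roots_of_unity (zeta : nat -> L) :=
  (forall m : nat, [pchar K]^'.-nat m -> m.-primitive_root (zeta m)) /\
  (forall m M : nat, [pchar K]^'.-nat m -> [pchar K]^'.-nat M ->
     (m %| M)%N -> zeta M ^+ (M %/ m) = zeta m).

(* The field K(A). *)
Definition adjoin (A : set L) : set L :=
  smallest [set F | GRing.divring_closed [in F]] (range iota `|` A).

(* e is a K-basis of F, for some family e of d elements. *)
Definition has_degree (F : set L) (d : nat) :=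
  exists e : 'I_d -> L,
    (forall c : 'I_d -> K,
       \sum_(i < d) iota (c i) * e i = 0 -> forall i, c i = 0) /\
    F = range (fun c : 'I_d -> K => \sum_(i < d) iota (c i) * e i).

End Extension.

(* Main.v *)
(* Let H = G K^*. If every odd prime root of unity zeta_l in H lies in K, then
   [K(H) : K] divides |H : K^*|: pick x in H \ K with x^p in K, p prime; then
   [K(x) : K] = p, and one continues over K(x). The hypothesis survives: if
   zeta_l = h a with h in H and a in K(x), one may assume that a power a^(l^k) is
   in K, so that the norm of a from K(a) is a^e times an l-power root of unity,
   e = [K(a) : K] dividing p; unless zeta_l is in K(x), this gives a^e in K, hence
   a in K, or l = p and a in K^* x^j by Kummer theory, so that zeta_l is in H.
   In general one first passes to K' = K(zeta_z), which divides the index by a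
   multiple of z. The hypothesis then holds for H K'^*: if a in K' \ K has
   a^(l^k) in K, a conjugate of a differs from a by a nontrivial l-power root of
   unity, which is in K' because K'/K is normal. *)

Require Import Defs.
From HB Require Import structures.
From mathcomp Require Import all_boot all_order all_algebra.
From mathcomp Require Import separable.
From mathcomp Require Import finmap boolp classical_sets functions cardinality.

Set Implicit Arguments.
Unset Strict Implicit.
Unset Printing Implicit Defensive.

Import GRing.Theory.
Local Open Scope ring_scope.
Local Open Scope classical_set_scope.

(** * Indices of multiplicative groups *)

Section Subgroups.
Variable L : fieldType.
Implicit Types (G H M N F : set L) (x y : L).

Lemma mul_subgroupP G :
  mul_subgroup G <->
  [/\ forall x, G x -> x != 0, G 1 & forall x y, G x -> G y -> G (x / y)].
Proof.
split=> [[G0 [G1 GV]] | [G0 G1 GV]].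
  split=> [x /G0 //||x y Gx Gy]; first by move: G1; rewrite in_setE.
  by have := GV x y; rewrite !in_setE; apply.
by split=> //; split=> [|x y]; rewrite !in_setE //; apply: GV.
Qed.

Section Operations.
Variables (G : set L) (Ggrp : mul_subgroup G).

Lemma mul_subgroup_neq0 x : G x -> x != 0.
Proof. by have /mul_subgroupP[G0 _ _] := Ggrp; apply: G0. Qed.

Lemma mul_subgroup1 : G 1.
Proof. by have /mul_subgroupP[] := Ggrp. Qed.

Lemma mul_subgroup_div x y : G x -> G y -> G (x / y).
Proof. by have /mul_subgroupP[_ _ GV] := Ggrp; apply: GV. Qed.

Lemma mul_subgroupV x : G x -> G x^-1.
Proof. by rewrite -div1r; apply/mul_subgroup_div/mul_subgroup1. Qed.

Lemma mul_subgroupM x y : G x -> G y -> G (x * y).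
Proof. by move=> Gx /mul_subgroupV Gy; rewrite -[y]invrK; apply: mul_subgroup_div. Qed.

Lemma mul_subgroupX x k : G x -> G (x ^+ k).
Proof.
move=> Gx; elim: k => [|k IH]; first by rewrite expr0; apply: mul_subgroup1.
by rewrite exprS; apply: mul_subgroupM.
Qed.

Lemma mul_subgroup_divl x y : G y -> G (x * y) -> G x.
Proof. by move=> Gy /mul_subgroup_div/(_ Gy); rewrite mulfK // mul_subgroup_neq0. Qed.

Lemma mul_subgroup_divr x y : G x -> G (x * y) -> G y.
Proof. by rewrite mulrC; apply: mul_subgroup_divl. Qed.

(** By division with remainder, the exponents bringing [x] into [G] are the multiples of the least
    positive one; [o] is the order of [x] modulo [G]. *)
Lemma order_mod x m : (0 < m)%N -> G (x ^+ m) ->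
  exists2 o, (0 < o)%N & forall j, G (x ^+ j) <-> (o %| j)%N.
Proof.
move=> m_gt0 Gm; have xn0 : x != 0.
  by apply/eqP=> x0; move: (mul_subgroup_neq0 Gm); rewrite x0 expr0n gtn_eqF ?eqxx.
have ex : exists k, (0 < k)%N && `[< G (x ^+ k) >].
  by exists m; rewrite m_gt0; apply/asboolP.
case: (ex_minnP ex) => o /andP[o_gt0 /asboolP Go] omin.
exists o => // j; split=> [Gj|/dvdnP[k ->]]; last first.
  by rewrite mulnC exprM; apply: mul_subgroupX.
rewrite /dvdn; have [//|jo0] := posnP (j %% o).
have := omin (j %% o)%N; rewrite jo0 leqNgt ltn_mod o_gt0 /=; move=> -> //.
apply/asboolP; move: Gj; rewrite {1}(divn_eq j o) exprD mulnC exprM.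
by apply: mul_subgroup_divr; apply: mul_subgroupX.
Qed.

(** The order of [x] modulo [G] divides both [a] and [b], hence is 1. *)
Lemma mul_subgroup_coprime x a b :
  (0 < a)%N -> coprime a b -> G (x ^+ a) -> G (x ^+ b) -> G x.
Proof.
move=> a_gt0 cab Ga Gb; have [o _ oP] := order_mod a_gt0 Ga.
rewrite -[x]expr1; apply/oP; rewrite -(eqP cab) dvdn_gcd.
by apply/andP; split; apply/oP.
Qed.

End Operations.

Lemma mul_subgroup_setI G H :
  mul_subgroup G -> mul_subgroup H -> mul_subgroup (G `&` H).
Proof.
move=> Gg Hg; apply/mul_subgroupP; split=> [x [/(mul_subgroup_neq0 Gg)] //||x y].
  by split; apply: mul_subgroup1.
by move=> [? ?] [? ?]; split; apply: mul_subgroup_div.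
Qed.

Lemma mul_subgroup_set_mul G H :
  mul_subgroup G -> mul_subgroup H -> mul_subgroup (set_mul G H).
Proof.
move=> Gg Hg; apply/mul_subgroupP; split.
- move=> _ [x Gx [y Hy <-]].
  by rewrite mulf_neq0 //; [exact: mul_subgroup_neq0 Gx | exact: mul_subgroup_neq0 Hy].
- exists 1; first exact: mul_subgroup1.
  by exists 1; [exact: mul_subgroup1 | rewrite mulr1].
move=> _ _ [x Gx [y Hy <-]] [x' Gx' [y' Hy' <-]].
exists (x / x'); first exact: mul_subgroup_div.
by exists (y / y'); [exact: mul_subgroup_div | rewrite mulf_div].
Qed.

Lemma set_mul_subl G H : mul_subgroup H -> G `<=` set_mul G H.
Proof. by move=> Hg x Gx; exists x => //; exists 1; rewrite ?mulr1 //; apply: mul_subgroup1. Qed.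

Lemma set_mul_subr G H : mul_subgroup G -> H `<=` set_mul G H.
Proof. by move=> Gg x Hx; exists 1; [apply: mul_subgroup1 | exists x; rewrite ?mul1r]. Qed.

Lemma set_mul_min G H M : mul_subgroup M -> G `<=` M -> H `<=` M -> set_mul G H `<=` M.
Proof. by move=> Mg GM HM _ [x /GM Gx [y /HM Hy <-]]; apply: mul_subgroupM. Qed.

(** Cosets are handled through lists of representatives, so that comparing indices becomes a
    manipulation of lists. *)
Definition transversal H N (s : seq L) :=
  [/\ uniq s, forall y, y \in s -> H y,
      forall x, H x -> exists2 y, y \in s & N (x / y)
    & forall y y', y \in s -> y' \in s -> N (y / y') -> y = y'].

(** Unlike [mul_index], this relation carries the finiteness of the index. *)
Definition has_index H N q := exists2 s, transversal H N s & size s = q.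

Lemma has_index_mul_index H N : mul_subgroup H -> mul_subgroup N ->
  finite_set (cosets H N) -> has_index H N (mul_index H N).
Proof.
move=> Hg Ng fin; pose S := fset_set (cosets H N).
pose rep (C : set L) := xget 1 [set h | H h /\ C = [set h * a | a in N]].
have repP C : C \in S -> H (rep C) /\ C = [set rep C * a | a in N].
  rewrite in_fset_set // in_setE => -[h Hh <-].
  by apply: (@xgetPex _ 1 [set h0 | H h0 /\ _]); exists h.
have eqC x y : N (x / y) -> [set x * a | a in N] `<=` [set y * a | a in N].
  move=> Nxy _ [a Na <-]; have yn0 : y != 0.
    by move: (mul_subgroup_neq0 Ng Nxy); rewrite mulf_eq0 invr_eq0 => /norP[].
  by exists (x / y * a); [exact: mul_subgroupM | rewrite mulrA mulrCA mulfV ?mulr1].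
have eqC2 x y : N (x / y) -> [set x * a | a in N] = [set y * a | a in N].
  move=> Nxy; apply/seteqP; split; apply: eqC => //.
  by rewrite -invf_div; apply: mul_subgroupV.
exists [seq rep C | C <- S]; last by rewrite size_map.
split.
- rewrite map_inj_in_uniq ?fset_uniq // => C D CS DS e.
  by rewrite (repP _ CS).2 (repP _ DS).2 e.
- by move=> _ /mapP[C CS ->]; exact: (repP _ CS).1.
- move=> x Hx; set C := [set x * a | a in N].
  have CS : C \in S by rewrite in_fset_set // in_setE; exists x.
  exists (rep C); first exact: map_f.
  have [Hr e] := repP _ CS; have : C x by exists 1; rewrite ?mulr1 //; apply: mul_subgroup1.
  by rewrite {1}e => -[a Na <-]; rewrite mulrAC mulfV ?mul1r // (mul_subgroup_neq0 Hg).
move=> _ _ /mapP[C CS ->] /mapP[D DS ->] /eqC2 e.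
by rewrite -(repP _ CS).2 -(repP _ DS).2 in e; rewrite e.
Qed.

(** Sending each element of one list to the representative of its class in the other is injective;
    by symmetry the lengths agree. *)
Lemma has_index_unique H N q q' : mul_subgroup N ->
  has_index H N q -> has_index H N q' -> q = q'.
Proof.
move=> Ng; wlog suff le: q q' / has_index H N q -> has_index H N q' -> (q <= q')%N.
  by move=> h h'; apply/eqP; rewrite eqn_leq !le.
move=> [s [us sH sc si] <-] [t [ut tH tc ti] <-].
pose f x := xget 1 [set y | y \in t /\ N (x / y)].
have fP x : x \in s -> f x \in t /\ N (x / f x).
  move=> /sH/tc[y yt Nxy]; apply: (@xgetPex _ 1 [set z | z \in t /\ N (x / z)]).
  by exists y.
rewrite -(size_map f); apply: uniq_leq_size => [|_ /mapP[x /fP[xt _] ->] //].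
rewrite map_inj_in_uniq // => x y xs ys e; apply: si => //.
have [_ Nx] := fP _ xs; have [/tH ft Ny] := fP _ ys.
move: (mul_subgroup_div Ng Nx Ny); rewrite e invf_div mulrA divfK //.
apply/eqP=> f0; move: (mul_subgroup_neq0 Ng Ny).
by rewrite f0 invr0 mulr0 eqxx.
Qed.

(** Products of a representative modulo [M] and a representative of [M] modulo [N] form a
    transversal: the class modulo [M] determines the first factor, which then cancels. *)
Lemma has_index_trans H M N a b :
  mul_subgroup H -> mul_subgroup M -> mul_subgroup N ->
  M `<=` H -> N `<=` M ->
  has_index H M a -> has_index M N b -> has_index H N (a * b).
Proof.
move=> Hg Mg Ng MH NM [s [us sH sc si] <-] [t [ut tM tc ti] <-].
have inj x y x' y' : x \in s -> y \in t -> x' \in s -> y' \in t ->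
    N (x * y / (x' * y')) -> x = x' /\ y = y'.
  move=> xs yt x's y't Nq.
  have e : x = x'.
    apply: si => //; apply: (mul_subgroup_divl Mg (mul_subgroup_div Mg (tM _ yt) (tM _ y't))).
    by rewrite mulf_div; apply: NM.
  split=> //; apply: ti => //; move: Nq; rewrite e -mulf_div divff ?mul1r //.
  exact: (mul_subgroup_neq0 Hg (sH _ x's)).
exists [seq x * y | x <- s, y <- t]; last exact: size_allpairs.
split.
- apply: allpairs_uniq => // -[x y] [x' y'] /allpairsP[[u v] [us' vt [-> ->]]].
  move=> /allpairsP[[u' v'] [us'' vt' [-> ->]]] /= e.
  have [|/= -> /= -> //] := inj _ _ _ _ us' vt us'' vt'.
  rewrite e divff; first exact: mul_subgroup1.
  by rewrite mulf_neq0 ?(mul_subgroup_neq0 Hg (sH _ us'')) ?(mul_subgroup_neq0 Mg (tM _ vt')).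
- move=> _ /allpairsP[[u v] [/= us' vt ->]].
  by apply: mul_subgroupM => //; [exact: sH | exact/MH/tM].
- move=> x /sc[y ys /tc[z zt Nz]]; exists (y * z); last by rewrite invfM mulrA.
  by apply/allpairsP; exists (y, z).
move=> _ _ /allpairsP[[u v] [/= us' vt ->]] /allpairsP[[u' v'] [/= us'' vt' ->]].
by move=> /inj[] // -> ->.
Qed.

Lemma div_trans a b c : a != 0 -> a / b * (c / a) = c / b :> L.
Proof. by move=> a0; rewrite mulf_div [a * c]mulrC -mulf_div divff ?mulr1. Qed.

Lemma div_cancel a b c d e : d != 0 -> c * d * (a / b / (e * d)) = c * a / (e * b) :> L.
Proof. by move=> d0; rewrite mulrA [c * d * _]mulrAC -mulf_div divff // mulr1 mulrAC mulf_div. Qed.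

(** Elements of [s] may lie outside [H]; each is replaced by an element of [H] in its class modulo
    [N], when there is one. *)
Lemma has_index_exists H N (s : seq L) :
  mul_subgroup N -> (forall x, H x -> exists2 y, y \in s & N (x / y)) ->
  exists q, has_index H N q.
Proof.
(* The default 0 marks a failed choice: as soon as [f y] is nonzero, it is a genuine element of the
   class. *)
move=> Ng sc; pose f y := xget 0 [set h | H h /\ N (h / y)].
pose t := [seq y <- undup [seq f y | y <- s] | `[< H y >]].
have fP y h : H h -> N (h / y) -> H (f y) /\ N (f y / y).
  by move=> Hh Nh; apply: (@xgetPex _ 0 [set h | H h /\ N (h / y)]); exists h.
have neq0 x y : N (x / y) -> x != 0 /\ y != 0.
  by move=> /(mul_subgroup_neq0 Ng); rewrite mulf_eq0 invr_eq0 => /norP[].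
exists (size t), t => //; split.
- by rewrite filter_uniq // undup_uniq.
- by move=> y; rewrite mem_filter => /andP[/asboolP].
- move=> x Hx; have [y ys Nxy] := sc x Hx; have [Hf Nf] := fP _ _ Hx Nxy.
  exists (f y).
    by rewrite mem_filter mem_undup map_f // andbT; apply/asboolP.
  have := mul_subgroup_div Ng Nxy Nf.
  by rewrite invf_div mulrA divfK //; have [] := neq0 _ _ Nxy.
move=> u v; rewrite !mem_filter !mem_undup.
move=> /andP[/asboolP Hy /mapP[y _ ey]] /andP[/asboolP Hz /mapP[z _ ez]].
rewrite {}ey {}ez {u v} in Hy Hz *.
move=> Nyz; have [fy0 fz0] := neq0 _ _ Nyz.
have Nfy : N (f y / y).
  by move: fy0; rewrite /f; case: xgetP => [w _ [] //|_]; rewrite eqxx.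
have Nfz : N (f z / z).
  by move: fz0; rewrite /f; case: xgetP => [w _ [] //|_]; rewrite eqxx.
have [_ y0] := neq0 _ _ Nfy; have [_ z0] := neq0 _ _ Nfz.
have Ny : N (z / y).
  have := mul_subgroup_div Ng (mul_subgroup_div Ng Nfy Nyz) Nfz.
  by rewrite !invf_div !div_trans.
(* Equal classes give equal sets to choose from, hence the same chosen element. *)
rewrite /f; congr (xget 0 _); apply/seteqP; split=> h [Hh Nh]; split=> //.
  by have := mul_subgroup_div Ng Nh Ny; rewrite invf_div mulrA divfK.
by have := mul_subgroupM Ng Nh Ny; rewrite mulrA divfK.
Qed.

(** The powers of [x] with exponent below [o] are representatives. Natural exponents suffice,
    because [x ^+ o] is in [N]. *)
Lemma has_index_cycle N x o : mul_subgroup N -> (0 < o)%N ->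
  (forall j, N (x ^+ j) <-> (o %| j)%N) ->
  has_index (set_mul [set x ^+ j | j in [set: nat]] N) N o.
Proof.
move=> Ng o_gt0 oP; have Nxo : N (x ^+ o) by apply/oP.
have x0 : x != 0.
  by apply/eqP=> x0; move: (mul_subgroup_neq0 Ng Nxo); rewrite x0 expr0n gtn_eqF ?eqxx.
have inj i j : (i < o)%N -> (j < o)%N -> N (x ^+ i / x ^+ j) -> i = j.
  wlog le_ij : i j / (i <= j)%N.
    move=> W io jo Nij; have [/W|/ltnW/W] := leqP i j; first exact.
    by move=> -> //; rewrite -invf_div; apply: mul_subgroupV.
  move=> io jo Nij; have : N (x ^+ (j - i)).
    by rewrite expfB_cond ?(negPf x0) // -invf_div; apply: mul_subgroupV.
  move=> /oP; rewrite /dvdn modn_small; last exact: leq_ltn_trans (leq_subr _ _) jo.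
  by rewrite subn_eq0 => ji; apply/eqP; rewrite eqn_leq le_ij.
exists [seq x ^+ j | j <- iota 0 o]; last by rewrite size_map size_iota.
split.
- rewrite map_inj_in_uniq ?iota_uniq // => i j; rewrite !mem_iota /= => io jo e.
  by apply: inj => //; rewrite e divff ?expf_neq0 //; apply: mul_subgroup1.
- move=> _ /mapP[j _ ->]; apply: set_mul_subl => //; by exists j.
- move=> _ [_ [j _ <-] [a Na <-]]; exists (x ^+ (j %% o)).
    by apply: map_f; rewrite mem_iota /= ltn_mod.
  rewrite {1}(divn_eq j o) exprD -!mulrA [_ * (a / _)]mulrC divfK ?expf_neq0 //.
  by apply: mul_subgroupM => //; rewrite mulnC exprM; apply: mul_subgroupX.
move=> _ _ /mapP[i + ->] /mapP[j + ->]; rewrite !mem_iota /= => io jo.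
by move=> /inj ->.
Qed.

Lemma has_index_base_change H N F q x o :
  mul_subgroup H -> mul_subgroup N -> mul_subgroup F ->
  N `<=` H -> N `<=` F -> has_index H N q ->
  H x -> F x -> (0 < o)%N -> (forall j, N (x ^+ j) <-> (o %| j)%N) ->
  exists q', has_index (set_mul H F) F q' /\ (o * q' %| q)%N.
Proof.
move=> Hg Ng Fg NH NF Hq Hx Fx o_gt0 oP.
have HFg := mul_subgroup_setI Hg Fg.
pose C := set_mul [set x ^+ j | j in [set: nat]] N.
have CHF : C `<=` H `&` F.
  apply: set_mul_min => // [_ [j _ <-]|y Ny]; last by split; [apply: NH | apply: NF].
  by split; apply: mul_subgroupX.
have Cg : mul_subgroup C.
  have xo : N (x ^+ o) by apply/oP.
  have x0 := mul_subgroup_neq0 Hg Hx.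
  apply/mul_subgroupP; split=> [y /CHF[/(mul_subgroup_neq0 Hg)] //||].
    by apply: set_mul_subl => //; exists 0%N; rewrite ?expr0.
  move=> _ _ [_ [i _ <-] [a Na <-]] [_ [j _ <-] [b Nb <-]].
  (* The inverse of [x ^+ j] is [x ^+ (j * o.-1)] divided by [(x ^+ o) ^+ j], and the latter is in
     [N]. *)
  exists (x ^+ (i + j * o.-1)); first by exists (i + j * o.-1)%N.
  exists ((a / b) / (x ^+ o) ^+ j).
    by apply: mul_subgroup_div; [|exact: mul_subgroup_div|exact: mul_subgroupX].
  have -> : (x ^+ o) ^+ j = x ^+ j * x ^+ (j * o.-1).
    by rewrite -exprM -exprD; case: (o) o_gt0 => // k _; rewrite mulSn mulnC.
  by rewrite exprD div_cancel // expf_neq0.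
have [s [_ _ sc _] _] := Hq.
have NC : N `<=` C.
  by move=> y Ny; exists 1; [exists 0%N; rewrite ?expr0 | exists y; rewrite ?mul1r].
(* A list representing [H] modulo [N] still meets all classes modulo larger groups, so the
   intermediate indices are finite. *)
have [q1 Hq1] : exists q, has_index H (H `&` F) q.
  apply: (@has_index_exists _ _ s) => // h /sc[y ys Ny]; exists y => //.
  by apply/CHF/NC.
have [q2 Hq2] : exists q, has_index (H `&` F) C q.
  apply: (@has_index_exists _ _ s) => // h [/sc[y ys Ny] _]; exists y => //.
  exact: NC.
have Ho := has_index_cycle Ng o_gt0 oP.
have Hq' := has_index_trans HFg Cg Ng CHF NC Hq2 Ho.
have Hq'' := has_index_trans Hg HFg Ng (@subIsetl _ _ _) (subset_trans NC CHF) Hq1 Hq'.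
exists q1; split; last first.
  by rewrite (has_index_unique Ng Hq Hq'') mulnCA [(o * q1)%N]mulnC dvdn_mull.
(* Representatives of [H] modulo the intersection also represent [set_mul H F] modulo [F]. *)
case: Hq1 => t [ut tH tc ti] <-; exists t => //; split=> //.
- by move=> y /tH; apply: set_mul_subl.
- move=> _ [h Hh [a Fa <-]]; have [y yt [_ Fy]] := tc _ Hh.
  by exists y => //; rewrite mulrAC; apply: mul_subgroupM.
by move=> y y' yt y't Fyy; apply: ti => //; split=> //; apply: mul_subgroup_div => //; apply: tH.
Qed.

End Subgroups.

(** * Subfields and degrees *)

Section Subfields.
Variable L : fieldType.
Implicit Types (F E : set L).

Lemma subfieldP F :
  GRing.divring_closed [in F] <->
  [/\ F 1, forall x y, F x -> F y -> F (x - y)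
    & forall x y, F x -> F y -> F (x / y)].
Proof.
split=> [[F1 FB FV] | [F1 FB FV]].
  split=> [|x y Fx Fy|x y Fx Fy]; first by move: F1; rewrite in_setE.
    by have := FB x y; rewrite !in_setE; apply.
  by have := FV x y; rewrite !in_setE; apply.
by split=> [|x y|x y]; rewrite !in_setE //; [apply: FB | apply: FV].
Qed.

Section Operations.
Variables (F : set L) (Ffield : GRing.divring_closed [in F]).

Lemma subfield1 : F 1.
Proof. by have /subfieldP[] := Ffield. Qed.

Lemma subfieldB x y : F x -> F y -> F (x - y).
Proof. by have /subfieldP[_ FB _] := Ffield; apply: FB. Qed.

Lemma subfield_div x y : F x -> F y -> F (x / y).
Proof. by have /subfieldP[_ _ FV] := Ffield; apply: FV. Qed.

Lemma subfield0 : F 0.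
Proof. by rewrite -(subrr 1); apply: subfieldB; apply: subfield1. Qed.

Lemma subfieldN x : F x -> F (- x).
Proof. by rewrite -sub0r; apply/subfieldB/subfield0. Qed.

Lemma subfieldD x y : F x -> F y -> F (x + y).
Proof. by move=> Fx /subfieldN Fy; rewrite -[y]opprK; apply: subfieldB. Qed.

Lemma subfieldV x : F x -> F x^-1.
Proof. by rewrite -div1r; apply/subfield_div/subfield1. Qed.

Lemma subfieldM x y : F x -> F y -> F (x * y).
Proof. by move=> Fx /subfieldV Fy; rewrite -[y]invrK; apply: subfield_div. Qed.

Lemma subfieldX x k : F x -> F (x ^+ k).
Proof.
move=> Fx; elim: k => [|k IH]; first by rewrite expr0; apply: subfield1.
by rewrite exprS; apply: subfieldM.
Qed.

Lemma subfield_sum (I : Type) (r : seq I) (P : pred I) (f : I -> L) :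
  (forall i, P i -> F (f i)) -> F (\sum_(i <- r | P i) f i).
Proof. by move=> Ff; apply: big_ind => //; [exact: subfield0 | exact: subfieldD]. Qed.

Lemma subfield_units : mul_subgroup (F `&` [set x | x != 0]).
Proof.
apply/mul_subgroupP; split=> [x []//||x y [Fx x0] [Fy y0]].
  by split; [exact: subfield1 | exact: oner_neq0].
by split; [exact: subfield_div | rewrite /= mulf_neq0 ?invr_eq0].
Qed.

End Operations.

Section SubfieldType.
Variables (F : set L) (Ffield : GRing.divring_closed [in F]).

(** The closure proof is a parameter, so that the algebraic structure can be inferred from the
    predicate alone. *)
Definition subfield_pred of GRing.divring_closed [in F] : {pred L} := [in F].

HB.instance Definition _ :=
  GRing.isDivringClosed.Build L (subfield_pred Ffield) Ffield.

Record subfield_type := SubfieldType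
  { subfield_val : L; _ : subfield_val \in subfield_pred Ffield }.

HB.instance Definition _ := [isSub for subfield_val].
HB.instance Definition _ := [Choice of subfield_type by <:].
HB.instance Definition _ := [SubChoice_isSubIntegralDomain of subfield_type by <:].
HB.instance Definition _ := [SubIntegralDomain_isSubField of subfield_type by <:].

End SubfieldType.

(** Degrees are taken over the source of a morphism, so an intermediate field must become a
    [fieldType] before it can serve as a new base. *)
Lemma subfield_as_field F : GRing.divring_closed [in F] ->
  exists (K : fieldType) (iota : {rmorphism K -> L}), range iota = F.
Proof.
move=> Ffield; exists (subfield_type Ffield : fieldType).
exists (val : {rmorphism (subfield_type Ffield : fieldType) -> L}).
apply/seteqP; split=> [_ [x _ <-]|x Fx].
  by have := valP x; rewrite unfold_in in_setE.
have xF : x \in subfield_pred Ffield by rewrite unfold_in in_setE.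
by exists (SubfieldType xF).
Qed.

End Subfields.

(** * Bases, degrees and adjunction *)

Section Degree.
Variables (K L : fieldType) (iota : {rmorphism K -> L}).
Implicit Types (F E V A : set L).

Definition linear_span n (f : 'I_n -> L) : set L :=
  range (fun c : 'I_n -> K => \sum_(i < n) iota (c i) * f i).

Definition linear_free n (f : 'I_n -> L) :=
  forall c : 'I_n -> K, \sum_(i < n) iota (c i) * f i = 0 -> forall i, c i = 0.

(** The matrix of coordinates of [e] in terms of [f] has independent rows, and its rank is at most
    its number of columns. *)
Lemma linear_free_le d n (e : 'I_d -> L) (f : 'I_n -> L) :
  linear_free e -> (forall i, linear_span f (e i)) -> (d <= n)%N.
Proof.
move=> e_free e_span.
have /choice[c cP] : forall i, exists c : 'I_n -> K, e i = \sum_(j < n) iota (c j) * f j.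
  by move=> i; have [c _ <-] := e_span i; exists c.
pose A := \matrix_(i, j) c i j.
suff /eqP <- : row_free A by apply: rank_leq_col.
apply: inj_row_free => v vA0; apply/rowP=> i; rewrite mxE.
apply: (e_free (fun i => v 0 i)); under eq_bigr do rewrite cP mulr_sumr.
rewrite exchange_big big1 // => j _.
have /(congr1 (fun B : 'rV_n => iota (B 0 j) * f j)) := vA0.
rewrite !mxE rmorph0 mul0r rmorph_sum mulr_suml => vA; rewrite -[RHS]vA.
by apply: eq_bigr => k _; rewrite mxE rmorphM mulrA.
Qed.

Lemma has_degree_le F E a b :
  has_degree iota F a -> has_degree iota E b -> F `<=` E -> (a <= b)%N.
Proof.
move=> [e [e_free ->]] [f [_ ->]] FE; apply: linear_free_le e_free _ => i.
apply: FE; exists (fun j => (j == i)%:R) => //.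
rewrite (bigD1 i) //= eqxx rmorph1 mul1r big1 ?addr0 // => j /negPf ->.
by rewrite rmorph0 mul0r.
Qed.

Lemma has_degree_unique F a b :
  has_degree iota F a -> has_degree iota F b -> a = b.
Proof.
by move=> Fa Fb; apply/eqP; rewrite eqn_leq !(has_degree_le Fa Fb, has_degree_le Fb Fa).
Qed.

(** Allows a basis indexed by pairs, as the tower law requires. *)
Lemma has_degree_fin (I : finType) (e : I -> L) F :
  (forall c : I -> K, \sum_i iota (c i) * e i = 0 -> forall i, c i = 0) ->
  F = range (fun c : I -> K => \sum_i iota (c i) * e i) ->
  has_degree iota F #|I|.
Proof.
have sumE (c : 'I_#|I| -> K) :
    \sum_(i < #|I|) iota (c i) * e (enum_val i) = \sum_i iota (c (enum_rank i)) * e i.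
  rewrite (reindex (@enum_rank I)); last exact/onW_bij/enum_rank_bij.
  by apply: eq_bigr => i _; rewrite enum_rankK.
move=> e_free ->; exists (e \o enum_val); split=> [c|].
  by rewrite sumE => /e_free c0 i; rewrite -[i]enum_valK.
apply/seteqP; split=> _ [c _ <-].
  exists (c \o enum_val) => //; rewrite sumE.
  by apply: eq_bigr => i _; rewrite /= enum_rankK.
by exists (c \o enum_rank) => //; rewrite -sumE.
Qed.

(** A free family in [V] of maximal length is a basis; lengths are bounded by [n] because [V] lies
    in the span of [f]. *)
Lemma has_degree_exists V n (f : 'I_n -> L) :
  V 0 -> (forall a x y, V x -> V y -> V (iota a * x + y)) ->
  V `<=` linear_span f -> exists d, has_degree iota V d.
Proof.
move=> V0 VZD Vf.
pose P d := `[< exists2 e : 'I_d -> L, linear_free e & forall i, V (e i) >].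
have Pn d : P d -> (d <= n)%N.
  by move=> /asboolP[e e_free Ve]; apply: linear_free_le e_free _ => i; apply: Vf.
have P0 : exists d, P d.
  by exists 0%N; apply/asboolP; exists (fun=> 0) => [c _ []|[]].
case: (ex_maxnP P0 Pn) => d /asboolP[e e_free Ve] dmax.
exists d, e; split=> //; apply/seteqP; split=> [x Vx|_ [c _ <-]]; last first.
  apply: big_ind => // [x y Vx Vy|i _]; last by rewrite -[_ * _]addr0; apply: VZD.
  by rewrite -[x]mul1r -(rmorph1 iota); apply: VZD.
(* Prepending [x] to [e] breaks freeness; in the resulting relation the coefficient of [x] is
   nonzero, since [e] is free, so [x] can be solved for. *)
pose g (i : 'I_d.+1) := if unlift ord0 i is Some j then e j else x.
have gS c : \sum_(i < d.+1) iota (c i) * g i =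
    iota (c ord0) * x + \sum_(i < d) iota (c (lift ord0 i)) * e i.
  rewrite big_ord_recl /g unlift_none; congr (_ + _).
  by apply: eq_bigr => i _; rewrite liftK.
have : ~ linear_free g.
  move=> g_free; have := dmax d.+1; rewrite ltnn => /(_ _)/notF[].
  apply/asboolP; exists g => // i; rewrite /g; case: unliftP => [j _|_] //.
move=> /existsNP[c /not_implyP[]]; rewrite gS => c0 /existsNP[i ci].
have c00 : c ord0 != 0.
  apply/eqP=> c00; apply: ci; move: c0; rewrite c00 rmorph0 mul0r add0r => /e_free cl0.
  by case: (unliftP ord0 i) => [j ->|->] //; apply: cl0.
exists (fun i => - (c ord0)^-1 * c (lift ord0 i)) => //.
under eq_bigr do rewrite rmorphM -mulrA.
move/eqP: c0; rewrite -mulr_sumr addrC addr_eq0 => /eqP ->.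
by rewrite rmorphN mulrNN mulrA -rmorphM mulVf // rmorph1 mul1r.
Qed.

Lemma range_subfield : GRing.divring_closed [in range iota].
Proof.
apply/subfieldP; split=> [|_ _ [x _ <-] [y _ <-]|_ _ [x _ <-] [y _ <-]].
- by exists 1; rewrite ?rmorph1.
- by exists (x - y); rewrite ?rmorphB.
by exists (x / y); rewrite ?rmorphM ?fmorphV.
Qed.

Lemma base_unitsE : base_units iota = range iota `&` [set x | x != 0].
Proof.
apply/seteqP; split=> [_ [a a0 <-]|_ [[a _ <-] a0]].
  by split; [exists a | rewrite /= fmorph_eq0].
by exists a => //; rewrite /= fmorph_eq0 in a0 *.
Qed.

Lemma base_units_subgroup : mul_subgroup (base_units iota).
Proof. by rewrite base_unitsE; apply/subfield_units/range_subfield. Qed.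

Lemma adjoin_subfield A : GRing.divring_closed [in adjoin iota A].
Proof.
apply/subfieldP; split=> [M [/= Mf _]|x y xA yA M [/= Mf MA]|x y xA yA M [/= Mf MA]].
- exact: (subfield1 Mf).
- by apply: (subfieldB Mf); [apply: xA | apply: yA].
by apply: (subfield_div Mf); [apply: xA | apply: yA].
Qed.

Lemma range_sub_adjoin A : range iota `<=` adjoin iota A.
Proof. by move=> x Kx M [_ MA]; apply: MA; left. Qed.

Lemma sub_adjoin A : A `<=` adjoin iota A.
Proof. by move=> x Ax M [_ MA]; apply: MA; right. Qed.

Lemma adjoin_min A F : GRing.divring_closed [in F] ->
  range iota `<=` F -> A `<=` F -> adjoin iota A `<=` F.
Proof. by move=> Ff KF AF x; apply; split=> // y []; [apply: KF | apply: AF]. Qed.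

Section Horner.
Variables (F : set L) (Ff : GRing.divring_closed [in F]) (KF : range iota `<=` F).

Lemma subfield_horner (g : {poly K}) x : F x -> F (map_poly iota g).[x].
Proof.
move=> Fx; rewrite horner_coef; apply: subfield_sum => // i _.
by apply: subfieldM => //; [rewrite coef_map; apply: KF; exists g`_i | exact: subfieldX].
Qed.

End Horner.

End Degree.

(** The products [e i * f j] form a basis. *)
Lemma has_degree_tower (K K1 L : fieldType) (iota : {rmorphism K -> L})
    (iota1 : {rmorphism K1 -> L}) E a b :
  has_degree iota (range iota1) a -> has_degree iota1 E b ->
  has_degree iota E (a * b).
Proof.
move=> [e [e_free eE]] [f [f_free fE]].
have in1 (c : 'I_a -> K) : exists u, iota1 u = \sum_(i < a) iota (c i) * e i.
  have : range iota1 (\sum_(i < a) iota (c i) * e i) by rewrite eE; exists c.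
  by case=> u _ <-; exists u.
have sumE (c : 'I_a * 'I_b -> K) : \sum_p iota (c p) * (e p.1 * f p.2) =
    \sum_(j < b) (\sum_(i < a) iota (c (i, j)) * e i) * f j.
  under [RHS]eq_bigr do rewrite mulr_suml.
  rewrite exchange_big pair_big /=; apply: eq_bigr => -[i j] _ /=.
  by rewrite mulrA.
rewrite -[a]card_ord -[b]card_ord -card_prod.
apply: (@has_degree_fin _ _ _ _ (fun p => e p.1 * f p.2)).
  move=> c; rewrite sumE => c0 [i j].
  have [u uP] := choice (fun j => in1 (fun i => c (i, j))).
  move: c0; under eq_bigr do rewrite -uP; move=> /f_free u0.
  by apply: (e_free (fun i => c (i, j))); rewrite -uP u0 rmorph0.
rewrite fE; apply/seteqP; split=> _ [c _ <-]; last first.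
  have [u uP] := choice (fun j => in1 (fun i => c (i, j))).
  by exists u => //; rewrite sumE; apply: eq_bigr => j _; rewrite uP.
have /choice[v vP] : forall j, exists v : 'I_a -> K,
    iota1 (c j) = \sum_(i < a) iota (v i) * e i.
  move=> j; have : range iota1 (iota1 (c j)) by exists (c j).
  by rewrite eE => -[v _ <-]; exists v.
by exists (fun p => v p.2 p.1) => //; rewrite sumE; apply: eq_bigr => j _; rewrite vP.
Qed.

(** A basis of [E] over [K] spans [E] over [K1], so [E] has a degree over [K1] and the tower law
    applies. *)
Lemma has_degree_dvd (K K1 L : fieldType) (iota : {rmorphism K -> L})
    (iota1 : {rmorphism K1 -> L}) E a d : GRing.divring_closed [in E] ->
  range iota `<=` range iota1 -> range iota1 `<=` E ->
  has_degree iota (range iota1) a -> has_degree iota E d -> (a %| d)%N.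
Proof.
move=> Ef K01 K1E Ka Ed; have [f [f_free fE]] := Ed.
have [b Eb] : exists b, has_degree iota1 E b.
  apply: (@has_degree_exists _ _ _ _ d f).
  - exact: subfield0.
  - move=> c x y Ex Ey; apply: subfieldD => //; apply: subfieldM => //.
    by apply: K1E; exists c.
  rewrite fE => _ [c _ <-].
  have /choice[u uP] : forall i, exists u, iota1 u = iota (c i).
    move=> i; have [|v _ <-] := K01 (iota (c i)); first by exists (c i).
    by exists v.
  by exists u => //; apply: eq_bigr => i _; rewrite uP.
by rewrite (has_degree_unique Ed (has_degree_tower Ka Eb)) dvdn_mulr.
Qed.

(** * Minimal polynomials of radicals *)

(** The order of [w] is a positive power of [l], so some power of [w] has order [l] and generates
    all [l]-th roots of unity. *)
Lemma subfield_root_of_unity (L : fieldType) (F : set L) l k (zl w : L) :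
  GRing.divring_closed [in F] -> prime l -> l.-primitive_root zl ->
  F w -> w ^+ (l ^ k) = 1 -> w != 1 -> F zl.
Proof.
move=> Ff l_pr zlP Fw wk w1.
have [|m mP m_dvd] := @prim_order_exists _ (l ^ k) w _ wk.
  by rewrite expn_gt0 prime_gt0.
have /(dvdn_pfactor _ _ l_pr)[[|j] jk mE] := m_dvd.
  by move: w1; rewrite -[w]expr1 -(expn0 l) -mE (prim_expr_order mP) eqxx.
have lm : (l %| m)%N by rewrite mE expnS dvdn_mulr.
have [i ->] := prim_rootP (dvdn_prim_root mP lm) (prim_expr_order zlP).
by do 2 apply: (subfieldX Ff).
Qed.

Section Algebraic.
Variables (K : fieldType) (L : closedFieldType) (iota : {rmorphism K -> L}).
Local Notation "p ^%" := (map_poly iota p) (at level 2, format "p ^%").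

(** This determines [P] up to a nonzero scalar; the degree of [x] is [(size P).-1]. *)
Definition is_minpoly x (P : {poly K}) :=
  [/\ P != 0, root P^% x & forall g : {poly K}, root g^% x -> P %| g].

(** A nonzero polynomial of least size vanishing at [x] works: remainders modulo it vanish at [x]
    and are smaller. *)
Lemma minpoly_exists x : algebraicOver iota x -> exists P, is_minpoly x P.
Proof.
case=> p p0 px.
pose Q n := `[< exists P : {poly K}, [/\ P != 0, root P^% x & size P = n] >].
have exQ : exists n, Q n by exists (size p); apply/asboolP; exists p.
case: (ex_minnP exQ) => n /asboolP[P [P0 Px Pn]] nmin.
exists P; split=> // g gx; rewrite /dvdp; apply/negPn/negP=> g0.
have := nmin (size (g %% P)); rewrite leqNgt -Pn ltn_modp P0 /= => /(_ _)/notF[].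
apply/asboolP; exists (g %% P); split=> //.
have := gx; rewrite {1}(divp_eq g P) rmorphD rmorphM /=.
by rewrite !rootE !hornerE (eqP Px) mulr0 add0r.
Qed.

Section Minpoly.
Variables (x : L) (P : {poly K}) (Pmin : is_minpoly x P).

Let P0 : P != 0. Proof. by case: Pmin. Qed.
Let Px : root P^% x. Proof. by case: Pmin. Qed.
Let PP (g : {poly K}) : root g^% x -> P %| g. Proof. by case: Pmin => _ _; apply. Qed.

Lemma minpoly_size_gt1 : (1 < size P)%N.
Proof. by rewrite -(size_map_poly iota); apply: root_size_gt1 Px; rewrite map_poly_eq0. Qed.

(** The gcd with [P] does not vanish at [x], so its cofactor in [P] does and is divisible by [P];
    hence the gcd is constant. *)
Lemma minpoly_ndvd_coprime g : ~~ root g^% x -> coprimep g P.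
Proof.
move=> gx; rewrite /coprimep; set d := gcdp g P.
have /dvdpP[u gE] : d %| g by apply: dvdp_gcdl.
have /dvdpP[h PE] : d %| P by apply: dvdp_gcdr.
have dx : ~~ root d^% x.
  by apply: contra gx; rewrite gE rmorphM rootM => ->; rewrite orbT.
have h0 : h != 0 by apply: contraNneq P0; rewrite PE => ->; rewrite mul0r.
have d0 : d != 0 by apply: contraNneq P0; rewrite PE => ->; rewrite mulr0.
have : root h^% x by have := Px; rewrite PE rmorphM rootM (negPf dx) orbF.
move=> /PP/dvdp_leq -/(_ h0); rewrite PE size_mul //.
have := size_poly_gt0 d; rewrite d0; case: (size d) => [//|s] _.
by rewrite addnS /= -[leqRHS]addn0 leq_add2l leqn0 => /eqP ->.
Qed.

(** Values at [x] depend only on the polynomial modulo [P], and a Bezout relation with [P] inverts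
    the nonzero ones. *)
Lemma adjoin1E :
  adjoin iota [set x] = [set g^%.[x] | g in [set g : {poly K} | (size g < size P)%N]].
Proof.
apply/seteqP; split=> [|_ [g _ <-]]; last first.
  apply: (subfield_horner (adjoin_subfield _ _)); first exact: range_sub_adjoin.
  exact: sub_adjoin.
set F := [set _ | _ in _].
have inF g : F g^%.[x].
  exists (g %% P); first by rewrite /= ltn_modp.
  by rewrite {2}(divp_eq g P) rmorphD rmorphM /= !hornerE (eqP Px) mulr0 add0r.
apply: adjoin_min.
- apply/subfieldP; split=> [|_ _ [g _ <-] [h _ <-]|_ _ [g _ <-] [h _ <-]].
  + by have := inF 1; rewrite rmorph1 hornerE.
  + by have := inF (g - h); rewrite rmorphB !hornerE.
  have [/eqP ->|hx] := boolP (root h^% x).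
    by rewrite invr0 mulr0; have := inF 0; rewrite rmorph0 hornerE.
  have [[u v] /= uv] := Bezout_eq1_coprimepP _ _ (minpoly_ndvd_coprime hx).
  have uh : u^%.[x] * h^%.[x] = 1.
    have := congr1 (fun q => q^%.[x]) uv.
    by rewrite rmorphD !rmorphM rmorph1 !hornerE (eqP Px) mulr0 addr0.
  have -> : g^%.[x] / h^%.[x] = (g * u)^%.[x]; last exact: inF.
  by rewrite rmorphM hornerM -[u^%.[x]](mulfK hx) uh mul1r.
- by move=> _ [c _ <-]; have := inF c%:P; rewrite map_polyC hornerC.
by move=> _ ->; have := inF 'X; rewrite map_polyX hornerX.
Qed.

Lemma adjoin1_degree : has_degree iota (adjoin iota [set x]) (size P).-1.
Proof.
set n := (size P).-1; have nE : size P = n.+1 by rewrite prednK // size_poly_gt0.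
have rowE (c : 'I_n -> K) :
    \sum_(i < n) iota (c i) * x ^+ i = (rVpoly (\row_i c i))^%.[x].
  rewrite (@horner_coef_wide _ n) ?size_map_poly ?size_poly //.
  by apply: eq_bigr => i _; rewrite coef_map coef_rVpoly_ord mxE.
exists (fun i => x ^+ i); split=> [c|].
  rewrite rowE => /eqP/PP/dvdp_leq.
  case: eqVneq => [g0 _ i|_ /(_ isT)]; last first.
    by rewrite nE leqNgt ltnS size_poly.
  by have := coef_rVpoly_ord (\row_i c i) i; rewrite g0 coef0 mxE.
rewrite adjoin1E nE; apply/seteqP; split=> [_ [g /= gn <-]|_ [c _ <-]].
  exists (fun i => g`_i) => //; rewrite (@horner_coef_wide _ n) ?size_map_poly //.
  by apply: eq_bigr => i _; rewrite coef_map.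
by rewrite rowE; exists (rVpoly (\row_i c i)) => //=; rewrite ltnS size_poly.
Qed.

Lemma minpoly_roots : {r : seq L | P^% = lead_coef P^% *: \prod_(z <- r) ('X - z%:P)
  & size P = (size r).+1}.
Proof.
have [r rE] := closed_field_poly_normal P^%; exists r => //.
by rewrite -(size_map_poly iota) rE size_scale ?size_prod_XsubC // lead_coef_eq0 map_poly_eq0.
Qed.

(* The conjugates of [x] are [x] times [N]-th roots of unity, so their product
   has the displayed shape. *)
Lemma minpoly_norm N : x != 0 -> range iota (x ^+ N) ->
  exists2 w, w ^+ N = 1 & range iota (x ^+ (size P).-1 * w).
Proof.
move=> x0 [c _ cE]; have [r rE rs] := minpoly_roots.
have lc0 : lead_coef P^% != 0 by rewrite lead_coef_eq0 map_poly_eq0.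
have rN z : z \in r -> z ^+ N = x ^+ N.
  move=> zr; have Pz : root P^% z by rewrite rE rootZ // root_prod_XsubC.
  have /dvdpP[q qE] : P %| 'X^N - c%:P.
    by apply: PP; rewrite rmorphB /= map_polyXn map_polyC rootE !hornerE /= cE subrr.
  have : root ('X^N - c%:P)^% z by rewrite qE rmorphM rootM Pz orbT.
  by rewrite rmorphB /= map_polyXn map_polyC rootE !hornerE /= cE subr_eq0 => /eqP.
exists (\prod_(z <- r) (z / x)).
  rewrite -prodrXl big_seq big1 // => z zr.
  by rewrite expr_div_n rN // divff // expf_neq0.
have prodE : \prod_(z <- r) z = x ^+ (size r) * \prod_(z <- r) (z / x).
  elim: (r) => [|z s IH]; first by rewrite !big_nil expr0 mulr1.
  by rewrite !big_cons IH exprS mulrACA [x * _]mulrC divfK.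
rewrite rs /= -prodE.
(* Up to sign and leading coefficient, the product of the roots is the constant term of [P], which
   lies in the base field. *)
have : iota P`_0 = lead_coef P^% * \prod_(z <- r) - z.
  rewrite -coef_map -horner_coef0 {1}rE hornerZ horner_prod; congr (_ * _).
  by apply: eq_bigr => z _; rewrite !hornerE.
have -> : \prod_(z <- r) - z = (-1) ^+ size r * \prod_(z <- r) z.
  elim: (r) => [|z s IH]; first by rewrite !big_nil mulr1.
  by rewrite !big_cons IH exprS mulrCA mulN1r !mulNr mulrN.
move=> /(canLR (mulKf lc0)) h.
exists ((-1) ^+ size r * ((lead_coef P)^-1 * P`_0)) => //.
by rewrite !rmorphM /= fmorphV -lead_coef_map h rmorphXn rmorphN1 signrMK.
Qed.

(** The degree is at most [p]. If it is smaller it is coprime to [p], and a Bezout relation between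
    the two extracts [x] times a root of unity from the norm and from [x ^+ p]. *)
Lemma minpoly_prime_radical p : prime p -> x != 0 -> range iota (x ^+ p) ->
  (size P).-1 = p \/ exists2 w, w ^+ p = 1 & range iota (x * w).
Proof.
move=> p_pr x0 Kxp; have [w wp Kxw] := minpoly_norm x0 Kxp.
have e_gt0 : (0 < (size P).-1)%N by rewrite -ltnS prednK ?minpoly_size_gt1 // size_poly_gt0.
have le_ep : ((size P).-1 <= p)%N.
  have [c _ cE] := Kxp; have XE := size_XnsubC c (prime_gt0 p_pr).
  rewrite -ltnS -[in leqRHS]XE prednK ?size_poly_gt0 //.
  apply: dvdp_leq; first by rewrite -size_poly_gt0 XE.
  by apply: PP; rewrite rmorphB /= map_polyXn map_polyC rootE !hornerE /= cE subrr.
move: le_ep; rewrite leq_eqVlt => /orP[/eqP|e_lt]; [by left | right].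
have /eqP ep : coprime (size P).-1 p by rewrite coprime_sym prime_coprime // gtnNdvd.
case: (egcdnP p e_gt0) => u v uv _; rewrite ep in uv.
have Kf := range_subfield iota.
exists (w ^+ u); first by rewrite exprAC wp expr1n.
have : range iota (((x ^+ p) ^+ v)^-1 * (x ^+ (size P).-1 * w) ^+ u).
  by apply: (subfieldM Kf); [apply/(subfieldV Kf)/(subfieldX Kf v) | apply: (subfieldX Kf u)].
rewrite exprMn -(exprM x _ u) mulnC uv exprD expr1 mulnC exprM !mulrA mulVf ?mul1r //.
by rewrite !expf_neq0.
Qed.

End Minpoly.

(** * Kummer and cyclotomic extensions *)

Lemma algebraicOver_radical x m : (0 < m)%N -> range iota (x ^+ m) -> algebraicOver iota x.
Proof.
move=> m_gt0 [c _ cE]; exists ('X^m - c%:P).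
  by rewrite -size_poly_gt0 size_XnsubC.
by rewrite rmorphB /= map_polyXn map_polyC rootE !hornerE /= cE subrr.
Qed.

Lemma expr_eq_mul_root n (zn a b : L) : n.-primitive_root zn -> a != 0 ->
  b ^+ n = a ^+ n -> exists i, b = zn ^+ i * a.
Proof.
move=> znP a0 e; have : (b / a) ^+ n = 1 by rewrite expr_div_n e divff // expf_neq0.
by move=> /(prim_rootP znP)[i iE]; exists i; rewrite -iE divfK.
Qed.

(** The root [zp] is annihilated by the sum of the ['X^i] for [i < p], of degree [p - 1]. *)
Lemma adjoin_root_of_unity_lt p (zp : L) d : prime p -> p.-primitive_root zp ->
  has_degree iota (adjoin iota [set zp]) d -> (d < p)%N.
Proof.
move=> p_pr zpP Hd; pose S : {poly K} := \sum_(i < p) 'X^i.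
have SE : S = \poly_(i < p) 1 by rewrite poly_def; apply: eq_bigr => i _; rewrite scale1r.
have Sp : size S = p.
  by rewrite SE size_poly_eq // oner_neq0.
have S0 : S != 0 by rewrite -size_poly_gt0 Sp prime_gt0.
have Sz : root S^% zp.
  have : (zp - 1) * S^%.[zp] = 0.
    rewrite /S rmorph_sum horner_sum; under eq_bigr do rewrite /= map_polyXn hornerXn.
    by rewrite -subrX1 (prim_expr_order zpP) subrr.
  move=> /eqP; rewrite mulf_eq0 subr_eq0 => /orP[/eqP z1|//].
  have := prim_order_dvd zpP 1; rewrite z1 expr1n eqxx.
  by rewrite dvdn1 => /eqP p1; move: p_pr; rewrite p1.
have [|Q Qmin] := @minpoly_exists zp; first by exists S.
rewrite (has_degree_unique Hd (adjoin1_degree Qmin)).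
have [Q0 _ QP] := Qmin.
by rewrite -ltnS prednK ?size_poly_gt0 // ltnS -[in leqRHS]Sp dvdp_leq // QP.
Qed.

(* Kummer theory: with [a = g.[x]], averaging [zp ^- (j t) * g.[zp ^+ t * x]]
   over [t] isolates the term of degree [j] of [g], and every [g.[zp ^+ t * x]]
   is a root of unity times [a]. *)
Lemma kummer p (zp x a : L) (P : {poly K}) : prime p -> p.-primitive_root zp ->
  is_minpoly x P -> (size P).-1 = p -> x != 0 -> range iota (x ^+ p) ->
  ~ adjoin iota [set x] zp ->
  a != 0 -> adjoin iota [set x] a -> range iota (a ^+ p) ->
  exists j, range iota (x ^+ j / a).
Proof.
move=> p_pr zpP Pmin Pp x0 Kx nzp a0 Ka Kap.
have [P0 Px PP] := Pmin.
have Xf := adjoin_subfield iota [set x]; have Zf := adjoin_subfield iota [set zp].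
have zp0 : zp != 0.
  apply/eqP=> z0; have /eqP := prim_expr_order zpP.
  by rewrite z0 expr0n gtn_eqF ?prime_gt0 // eq_sym oner_eq0.
have Zz i : adjoin iota [set zp] (zp ^+ i) by apply: (subfieldX Zf i); apply: sub_adjoin.
have := Ka; rewrite (adjoin1E Pmin) => -[g /= gP ga].
have gp : (size g <= p)%N by rewrite -Pp -ltnS prednK // size_poly_gt0.
have g0 : g != 0 by apply: contra_neq a0 => g0; rewrite -ga g0 rmorph0 horner0.
have [b _ bE] := Kx; have [c _ cE] := Kap.
have PX : P %= 'X^p - b%:P.
  have XE := size_XnsubC b (prime_gt0 p_pr).
  rewrite -dvdp_size_eqp ?XE -?Pp ?prednK ?size_poly_gt0 //.
  by apply: PP; rewrite rmorphB /= map_polyXn map_polyC rootE !hornerE /= Pp bE subrr.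
(* The polynomial [g ^+ p - c] vanishes at [x], hence at every conjugate [zp ^+ t * x]. *)
have conj t : exists i, g^%.[zp ^+ t * x] = zp ^+ i * a.
  apply: (expr_eq_mul_root zpP a0); apply/eqP; rewrite -subr_eq0.
  have /dvdpP[q qE] : 'X^p - b%:P %| g ^+ p - c%:P.
    rewrite -(eqp_dvdl _ PX); apply: PP.
    by rewrite rmorphB /= rmorphXn /= map_polyC rootE !hornerE /= ga cE subrr.
  have : root (g ^+ p - c%:P)^% (zp ^+ t * x).
    rewrite qE rmorphM rootM; apply/orP; right.
    rewrite rmorphB /= map_polyXn map_polyC rootE !hornerE /= bE exprMn.
    by rewrite exprAC (prim_expr_order zpP) expr1n mul1r subrr.
  by rewrite rmorphB /= rmorphXn /= map_polyC rootE !hornerE /= cE.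
have [i iE] := choice conj.
pose j := (size g).-1; pose y := x ^+ j / a.
have jp : (j < p)%N by rewrite prednK // size_poly_gt0.
pose s := \sum_(t < p) (zp ^- j) ^+ t * zp ^+ i t.
have termE (t k : nat) : (zp ^- j) ^+ t * (iota g`_k * (zp ^+ t * x) ^+ k) =
    iota g`_k * x ^+ k * (zp ^+ k / zp ^+ j) ^+ t.
  rewrite exprMn -exprM [(t * k)%N]mulnC exprM expr_div_n exprVn.
  by rewrite mulrC [_ ^+ t * x ^+ k]mulrC !mulrA.
(* Orthogonality of characters: for [k] other than [j] the sum over [t] is a geometric sum of a
   nontrivial [p]-th root of unity, hence 0. *)
have sE : s * a = p%:R * (iota g`_j * x ^+ j).
  have -> : s * a = \sum_(t < p) \sum_(k < p) iota g`_k * x ^+ k * (zp ^+ k / zp ^+ j) ^+ t.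
    rewrite mulr_suml; apply: eq_bigr => t _.
    rewrite -mulrA -iE (@horner_coef_wide _ p) ?size_map_poly // mulr_sumr.
    by apply: eq_bigr => k _; rewrite coef_map termE.
  rewrite exchange_big (bigD1 (Ordinal jp)) //= [X in _ + X]big1 => [|k kj].
    rewrite divff ?expf_neq0 //; under eq_bigr do rewrite expr1n mulr1.
    by rewrite sumr_const card_ord addr0 mulr_natl.
  rewrite -mulr_sumr; set u := zp ^+ k / zp ^+ j.
  have u1 : u - 1 != 0.
    rewrite subr_eq0; apply: contra kj => /eqP/(canRL (divfK (expf_neq0 j zp0))).
    by rewrite mul1r => /eqP; rewrite (eq_prim_root_expr zpP) !modn_small.
  have /eqP := subrX1 u p; rewrite expr_div_n !(exprAC _ _ p) (prim_expr_order zpP).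
  rewrite !expr1n divr1 subrr eq_sym mulf_eq0 (negPf u1) => /eqP ->.
  by rewrite mulr0.
have gj0 : iota g`_j != 0 by rewrite fmorph_eq0 -lead_coefE lead_coef_eq0.
have pn0 : p%:R != 0 :> L by apply: prim_root_natf_neq0 zpP.
have y0 : y != 0 by rewrite mulf_neq0 ?invr_eq0 // expf_neq0.
have Zs : adjoin iota [set zp] s.
  apply: (subfield_sum Zf) => t _; apply: (subfieldM Zf); last exact: Zz.
  by apply: (subfieldX Zf); apply: (subfieldV Zf); apply: Zz.
have Zy : adjoin iota [set zp] y.
  have yE : y = s / (p%:R * iota g`_j).
    apply/(canRL (mulfK _)); first by rewrite mulf_neq0.
    by rewrite /y mulrC mulrA -[p%:R * _ * _]mulrA -sE mulfK.
  rewrite yE; apply: (subfield_div Zf Zs); apply: range_sub_adjoin.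
  by exists (p%:R * g`_j) => //; rewrite rmorphM rmorph_nat.
have Ky : range iota (y ^+ p).
  rewrite expr_div_n exprAC; apply: subfield_div => //; first exact: range_subfield.
  by apply: subfieldX => //; apply: range_subfield.
have [R Rmin] := minpoly_exists (algebraicOver_radical (prime_gt0 p_pr) Ky).
(* Degree [p] is impossible for [y], since [y] lies in the field generated by [zp], of degree less
   than [p]. *)
have [Rp|[w wp Kw]] := minpoly_prime_radical Rmin p_pr y0 Ky.
  have [|Q Qmin] := @minpoly_exists zp.
    apply: (@algebraicOver_radical _ p); first exact: prime_gt0.
    by rewrite (prim_expr_order zpP); apply: subfield1; apply: range_subfield.
  have := adjoin_root_of_unity_lt p_pr zpP (adjoin1_degree Qmin).
  rewrite ltnNge -{1}Rp (has_degree_le (adjoin1_degree Rmin) (adjoin1_degree Qmin)) //.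
  by apply: adjoin_min => //; [exact: range_sub_adjoin | move=> _ ->].
(* If [w] were nontrivial, then [w], the quotient of [y * w] by [y], would put [zp] into the field
   generated by [x]. *)
exists j; have [w1|w1] := eqVneq w 1; first by move: Kw; rewrite w1 mulr1.
case: nzp; apply: (@subfield_root_of_unity _ _ p 1 _ w) => //.
have Xy : adjoin iota [set x] y.
  by apply: (subfield_div Xf) Ka; apply: (subfieldX Xf); apply: sub_adjoin.
have := subfield_div Xf (range_sub_adjoin Kw) Xy.
by rewrite mulrC mulKf.
Qed.

(** Write [a] as [g] evaluated at [zz]. The conjugates of [zz] are powers of it, so [g] takes values
    in the same field at all of them. Either all these values are [a], and [g] is constant, or one
    of them divided by [a] is the required root of unity. *)
Lemma cyclotomic_radical z (zz a : L) N : z.-primitive_root zz ->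
  adjoin iota [set zz] a -> range iota (a ^+ N) ->
  range iota a \/ exists w, [/\ adjoin iota [set zz] w, w ^+ N = 1 & w != 1].
Proof.
move=> zzP Za KaN; have Zf := adjoin_subfield iota [set zz].
have [a0|a0] := eqVneq a 0.
  by left; rewrite a0; apply: subfield0; apply: range_subfield.
have z_gt0 := prim_order_gt0 zzP.
have zz1 : range iota (zz ^+ z).
  by rewrite (prim_expr_order zzP); apply: subfield1; apply: range_subfield.
have [P Pmin] := minpoly_exists (algebraicOver_radical z_gt0 zz1).
have [P0 Px PP] := Pmin; have [r rE rs] := minpoly_roots Pmin.
have lc0 : lead_coef P^% != 0 by rewrite lead_coef_eq0 map_poly_eq0.
have Pz : P^% %| 'X^z - 1.
  have -> : 'X^z - 1 = ('X^z - 1)^% :> {poly L}.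
    by rewrite rmorphB /= map_polyXn rmorph1.
  rewrite dvdp_map; apply: PP.
  by rewrite rmorphB /= map_polyXn rmorph1 rootE !hornerE (prim_expr_order zzP) subrr.
(* The roots of [P] are distinct because [P] divides ['X^z - 1], a product of distinct linear
   factors. *)
have rU : uniq r.
  rewrite -separable_prod_XsubC -(eqp_separable (eqp_scale _ lc0)) -rE.
  apply: dvdp_separable Pz _; rewrite -(factor_Xn_sub_1 zzP).
  rewrite -(big_map (fun i => zz ^+ i) xpredT (fun u => 'X - u%:P)) separable_prod_XsubC.
  rewrite map_inj_in_uniq ?iota_uniq // => i k; rewrite !mem_index_iota /= => iz kz /eqP.
  by rewrite (eq_prim_root_expr zzP) !modn_small // => /eqP.
have rroot y : y \in r -> root P^% y by move=> yr; rewrite rE rootZ // root_prod_XsubC.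
have rZ y : y \in r -> adjoin iota [set zz] y.
  move=> /rroot Py; have : root ('X^z - 1) y by have /dvdpP[q ->] := Pz; rewrite rootM Py orbT.
  rewrite rootE !hornerE subr_eq0 => /eqP/(prim_rootP zzP)[i ->].
  by apply: (subfieldX Zf); apply: sub_adjoin.
have := Za; rewrite {1}(adjoin1E Pmin) => -[g /= gP ga]; have [c _ cE] := KaN.
have rN y : y \in r -> g^%.[y] ^+ N = a ^+ N.
  move=> /rroot Py; apply/eqP; rewrite -subr_eq0.
  have /dvdpP[q qE] : P %| g ^+ N - c%:P.
    by apply: PP; rewrite rmorphB /= rmorphXn /= map_polyC rootE !hornerE /= ga cE subrr.
  have : root (g ^+ N - c%:P)^% y by rewrite qE rmorphM rootM Py orbT.
  by rewrite rmorphB /= rmorphXn /= map_polyC rootE !hornerE /= cE.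
have [all_a|/allPn[y yr gy]] := boolP (all (fun y => g^%.[y] == a) r).
  left; have [e|ne] := eqVneq (g^% - a%:P) 0.
    exists g`_0 => //; rewrite -coef_map; move/eqP: e; rewrite subr_eq0 => /eqP ->.
    by rewrite coefC.
  (* The size of [g - a] is at most the number of conjugates, too small for a nonzero polynomial
     vanishing at all of them. *)
  have := max_poly_roots ne _ rU; rewrite ltnNge => /(_ _)/negP[].
    apply/allP=> y yr; rewrite rootE !hornerE subr_eq0.
    by have /allP := all_a; apply.
  have r_gt0 : (0 < size r)%N by have := minpoly_size_gt1 Pmin; rewrite rs.
  apply: leq_trans (size_polyD _ _) _; rewrite size_map_poly size_polyN geq_max.
  by rewrite -ltnS -rs gP /= (leq_trans (size_polyC_leq1 _)).
right; exists (g^%.[y] / a); split.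
- exact: (subfield_div Zf (subfield_horner Zf (@range_sub_adjoin _ _ _ _) _ (rZ _ yr)) Za).
- by rewrite expr_div_n rN // divff // expf_neq0.
by apply: contra gy => /eqP/(canRL (divfK a0)) ->; rewrite mul1r.
Qed.

End Algebraic.

(** * Degrees of radical extensions *)

Lemma base_unitsP (K L : fieldType) (iota : {rmorphism K -> L}) x :
  base_units iota x <-> range iota x /\ x != 0.
Proof. by rewrite base_unitsE. Qed.

Lemma prime_root_of_unity (L : fieldType) p (zp w : L) : prime p ->
  p.-primitive_root zp -> w ^+ p = 1 -> w != 1 -> exists i, zp = w ^+ i.
Proof.
move=> p_pr zpP wp w1.
have [m mP m_dvd] := prim_order_exists (prime_gt0 p_pr) wp.
have m1 : m != 1%N.
  by apply: contra_neq w1 => m1; have := prim_expr_order mP; rewrite m1 expr1.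
have mp : m = p by apply/(prime_nt_dvdP p_pr m1).
by rewrite mp in mP; have [i ->] := prim_rootP mP (prim_expr_order zpP); exists i.
Qed.

(* Replacing [h] by a suitable power, its order modulo [N] becomes a power of [l]. *)
Lemma set_mul_root_of_unity (L : fieldType) (H F N : set L) l x :
  mul_subgroup H -> mul_subgroup F -> mul_subgroup N -> prime l ->
  (forall h, H h -> exists2 m, (0 < m)%N & N (h ^+ m)) ->
  set_mul H F x -> x ^+ l = 1 ->
  exists h a k, [/\ H h, F a, x = h * a & N (a ^+ (l ^ k))].
Proof.
move=> Hg Fg Ng l_pr HN [h Hh [a Fa hax]] xl.
have [m m_gt0 Nhm] := HN h Hh.
have [m' lm' mE] := pfactor_coprime l_pr m_gt0; set k := logn l m in mE.
have m'_gt0 : (0 < m')%N by move: m_gt0; rewrite mE muln_gt0 => /andP[].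
case: (egcdnP l m'_gt0) => u v uv _.
have /eqP gcd1 : coprime m' l by rewrite coprime_sym.
rewrite gcd1 addn1 in uv.
(* As [u * m'] is 1 modulo [l], raising [h * a] to this power fixes [x] and leaves [h] of [l]-power
   order modulo [N]. *)
have xE : x ^+ (u * m') = x by rewrite uv exprS mulnC exprM xl expr1n mulr1.
(* The exponent [k.+1] ensures that [x ^+ (l ^ k.+1)] is 1 even when [k] is 0. *)
exists (h ^+ (u * m')), (a ^+ (u * m')), k.+1; split.
- exact: (mul_subgroupX Hg).
- exact: (mul_subgroupX Fg).
- by rewrite -exprMn hax xE.
have Nh : N ((h ^+ (u * m')) ^+ (l ^ k.+1)).
  have -> : (h ^+ (u * m')) ^+ (l ^ k.+1) = (h ^+ m) ^+ (u * l).
    by rewrite -!exprM mE expnSr [(m' * _ * _)%N]mulnACA [(m' * u)%N]mulnC.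
  exact: (mul_subgroupX Ng).
apply: (mul_subgroup_divr Ng Nh); rewrite -!exprMn hax xE expnS exprM xl expr1n.
exact: (mul_subgroup1 Ng).
Qed.

(** Changing the base to an intermediate field generated by part of [H] leaves the top field
    unchanged. *)
Lemma adjoin_tower (K K1 L : fieldType) (iota : {rmorphism K -> L})
    (iota1 : {rmorphism K1 -> L}) (H B : set L) :
  range iota1 = adjoin iota B -> B `<=` H ->
  adjoin iota1 (set_mul H (base_units iota1)) = adjoin iota H.
Proof.
move=> K1E BH; have Hf := adjoin_subfield iota H.
have K1H : range iota1 `<=` adjoin iota H.
  rewrite K1E; apply: adjoin_min => //; first exact: range_sub_adjoin.
  by apply: subset_trans BH _; apply: sub_adjoin.
apply/seteqP; split; apply: adjoin_min => //.
- move=> _ [h Hh [a /base_unitsP[K1a _] <-]].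
  by apply: (subfieldM Hf); [apply: sub_adjoin | apply: K1H].
- exact: adjoin_subfield.
- apply: subset_trans (@range_sub_adjoin _ _ _ _).
  by rewrite K1E; apply: range_sub_adjoin.
apply: subset_trans (@sub_adjoin _ _ _ _).
exact/set_mul_subl/base_units_subgroup.
Qed.

(** * Extensions without new roots of unity *)

Section Kneser.
Variables (L : closedFieldType) (zeta : nat -> L).
Hypothesis zetaP : forall l, prime l -> l \notin [pchar L] -> l.-primitive_root (zeta l).

(** The invariant of the induction. The prime 2 is left out since its root of unity -1 is in every
    base field, and the characteristic since it has no primitive root. *)
Definition no_new_roots (K : fieldType) (iota : {rmorphism K -> L}) (H : set L) :=
  forall l, prime l -> odd l -> l \notin [pchar L] -> H (zeta l) -> range iota (zeta l).

Lemma no_new_roots_prime_step (K K1 : fieldType) (iota : {rmorphism K -> L})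
    (iota1 : {rmorphism K1 -> L}) (H : set L) p x (P : {poly K}) :
  mul_subgroup H -> base_units iota `<=` H ->
  (forall h, H h -> exists2 m, (0 < m)%N & base_units iota (h ^+ m)) ->
  no_new_roots iota H -> prime p -> H x -> is_minpoly iota x P -> (size P).-1 = p ->
  range iota (x ^+ p) -> range iota1 = adjoin iota [set x] ->
  no_new_roots iota1 (set_mul H (base_units iota1)).
Proof.
move=> Hg KH Hrad Hroots p_pr Hx Pmin Pp Kxp K1E l l_pr l_odd l_char Hzl.
have Kg := base_units_subgroup iota; have K1g := base_units_subgroup iota1.
have K1f := range_subfield iota1; have zlP := zetaP l_pr l_char.
have K01 : range iota `<=` range iota1 by rewrite K1E; apply: range_sub_adjoin.
have x0 := mul_subgroup_neq0 Hg Hx.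
apply: contrapT => nzl.
have [h [a [k [Hh K1a zE Ka]]]] :=
  set_mul_root_of_unity Hg K1g Kg l_pr Hrad Hzl (prim_expr_order zlP).
(* Once [a] is in [H], so is [zeta l], which the hypothesis then places in the smaller base
   field. *)
suff Ha : H a.
  by apply/nzl/K01/Hroots => //; rewrite zE; apply: (mul_subgroupM Hg).
have [K1a' a0] := (base_unitsP _ _).1 K1a; have [Ka' _] := (base_unitsP _ _).1 Ka.
have lk_gt0 : (0 < l ^ k)%N by rewrite expn_gt0 prime_gt0.
have [Q Qmin] := minpoly_exists (algebraicOver_radical lk_gt0 Ka').
have [w wl Kw] := minpoly_norm Qmin a0 Ka'.
(* A nontrivial [w] is an [l]-power root of unity in the field of [x], forcing [zeta l] into it. *)
have [w1|w1] := eqVneq w 1; last first.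
  case: nzl; apply: (subfield_root_of_unity K1f l_pr zlP _ wl w1).
  have := subfield_div K1f (K01 _ Kw) (subfieldX K1f (size Q).-1 K1a').
  by rewrite mulrC mulKf // expf_neq0.
rewrite w1 mulr1 in Kw.
have Qp : ((size Q).-1 %| p)%N.
  have [K2 [iota2 K2E]] := subfield_as_field (adjoin_subfield iota [set a]).
  rewrite -Pp; apply: (has_degree_dvd (iota1 := iota2)) (adjoin1_degree Pmin).
  - exact: adjoin_subfield.
  - by rewrite K2E; apply: range_sub_adjoin.
  - rewrite K2E -K1E; apply: adjoin_min => //; by move=> _ ->.
  by rewrite K2E; apply: adjoin1_degree.
have toK b : range iota b -> b != 0 -> base_units iota b.
  by move=> ? ?; apply/base_unitsP.
have /orP[/eqP e1|/eqP ep] := (primeP p_pr).2 _ Qp.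
  by rewrite e1 expr1 in Kw; apply/KH/toK.
rewrite ep in Kw.
(* If [l] differs from [p], the coprime powers [a ^+ p] and [a ^+ (l ^ k)] are both in the base
   field, hence so is [a]. If [l = p], Kummer theory compares [a] with a power of [x]. *)
have [lp|lp] := eqVneq l p; last first.
  apply/KH/(mul_subgroup_coprime Kg (prime_gt0 p_pr) _ _ Ka).
    by rewrite coprimeXr // prime_coprime // dvdn_prime2 // eq_sym.
  by apply: toK; rewrite ?expf_neq0.
rewrite -lp in Pp Kxp Kw; rewrite K1E in nzl K1a'.
have [j Kj] := kummer l_pr zlP Pmin Pp x0 Kxp nzl a0 K1a' Kw.
have : H (x ^+ j / (x ^+ j / a)).
  apply: (mul_subgroup_div Hg); first exact: (mul_subgroupX Hg).
  by apply/KH/toK; rewrite // mulf_neq0 ?invr_eq0 ?expf_neq0.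
by rewrite invf_div mulrC divfK // expf_neq0.
Qed.

(** Strong induction on the index, with the base field generalised because each step enlarges it by
    an element of prime degree. *)
Lemma degree_dvd_index q (K : fieldType) (iota : {rmorphism K -> L}) (H : set L) :
  mul_subgroup H -> base_units iota `<=` H ->
  (forall h, H h -> exists2 m, [pchar L]^'.-nat m & base_units iota (h ^+ m)) ->
  no_new_roots iota H -> has_index H (base_units iota) q ->
  exists2 d, has_degree iota (adjoin iota H) d & (d %| q)%N.
Proof.
elim/ltn_ind: q K iota H => q IH K iota H Hg KH Hrad Hroots Hq.
have Kg := base_units_subgroup iota; have Kf := range_subfield iota.
have [HK|/existsNP[h /not_implyP[Hh nKh]]] := pselect (H `<=` base_units iota).
  exists 1%N => //; exists (fun=> 1); split=> [c|].
    rewrite big_ord1 mulr1 => /eqP; rewrite fmorph_eq0 => /eqP c0 i.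
    by rewrite ord1.
  apply/seteqP; split=> [|_ [c _ <-]]; last first.
    by rewrite big_ord1 mulr1; apply: range_sub_adjoin; exists (c ord0).
  apply: (@subset_trans _ (range iota)) => [|_ [c _ <-]].
    by apply: adjoin_min => //; move=> y /HK/base_unitsP[].
  by exists (fun=> c) => //; rewrite big_ord1 mulr1.
have [m m_char Khm] := Hrad _ Hh.
have m_gt0 : (0 < m)%N by case/andP: m_char.
have [o o_gt0 oP] := order_mod Kg m_gt0 Khm.
have o1 : o != 1%N by apply: contra_not_neq nKh => o1; rewrite -[h]expr1; apply/oP; rewrite o1.
have p_pr : prime (pdiv o) by rewrite pdiv_prime // ltn_neqAle eq_sym o1.
set p := pdiv o in p_pr; have p_dvd : (p %| o)%N by apply: pdiv_dvd.
have p_char : p \notin [pchar L].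
  have om : (o %| m)%N by apply/oP.
  by have := pnat_dvd (dvdn_trans p_dvd om) m_char; rewrite pnatE.
(* This power of [h] has order exactly [p] modulo the base field. *)
pose x := h ^+ (o %/ p).
have Hx : H x by apply: (mul_subgroupX Hg).
have x0 := mul_subgroup_neq0 Hg Hx.
have xP j : base_units iota (x ^+ j) <-> (p %| j)%N.
  rewrite /x -exprM; split=> [/oP|pj]; last apply/oP.
    rewrite -{1}(divnK p_dvd) dvdn_pmul2l // divn_gt0 ?prime_gt0 //.
    exact: dvdn_leq.
  by rewrite -{1}(divnK p_dvd) dvdn_mul.
have Kxp : range iota (x ^+ p) by have /base_unitsP[] : base_units iota (x ^+ p) by apply/xP.
have nKx : ~ range iota x.
  move=> Kx; have /xP : base_units iota (x ^+ 1) by apply/base_unitsP; rewrite expr1.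
  by rewrite dvdn1 => /eqP p1; move: p_pr; rewrite p1.
have zpP := zetaP p_pr p_char.
have [P Pmin] := minpoly_exists (algebraicOver_radical (prime_gt0 p_pr) Kxp).
(* Otherwise [x * w] is in the base field for some [p]-th root of unity [w]. Then [w] is in [H], so
   by [Hroots] the [p]-th roots of unity, and with them [x], are in the base field. *)
have Pp : (size P).-1 = p.
  have [//|[w wp Kxw]] := minpoly_prime_radical Pmin p_pr x0 Kxp.
  have w0 : w != 0.
    by apply/eqP=> w0; move/eqP: wp; rewrite w0 expr0n gtn_eqF ?prime_gt0 // eq_sym oner_eq0.
  case: nKx; have [w1|w1] := eqVneq w 1; first by move: Kxw; rewrite w1 mulr1.
  have Hw : H w.
    apply: (mul_subgroup_divr Hg Hx); apply/KH/base_unitsP.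
    by split=> //; rewrite mulf_neq0.
  have Kzp : range iota (zeta p).
    have [p_odd|p_even] := boolP (odd p).
      apply: Hroots => //; have [i ->] := prime_root_of_unity p_pr zpP wp w1.
      exact: (mul_subgroupX Hg).
    have p2 : p = 2%N by have [//|] := even_prime p_pr; rewrite (negPf p_even).
    have /eqP := prim_expr_order zpP; rewrite {2}p2 sqrf_eq1 => /orP[]/eqP ->.
      exact: (subfield1 Kf).
    by apply: (subfieldN Kf); apply: (subfield1 Kf).
  have [i wE] := prim_rootP zpP wp.
  rewrite -(mulfK w0 x); apply: (subfield_div Kf) => //.
  by rewrite wE; apply: (subfieldX Kf).
have [K1 [iota1 K1E]] := subfield_as_field (adjoin_subfield iota [set x]).
have K1g := base_units_subgroup iota1.
have K01 : base_units iota `<=` base_units iota1.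
  move=> y /base_unitsP[Ky y0]; apply/base_unitsP; split=> //.
  by rewrite K1E; apply: range_sub_adjoin.
have K1x : base_units iota1 x.
  by apply/base_unitsP; split=> //; rewrite K1E; apply: sub_adjoin.
have [q1 [Hq1 pq1]] :=
  has_index_base_change Hg Kg K1g KH K01 Hq Hx K1x (prime_gt0 p_pr) xP.
have q_gt0 : (0 < q)%N.
  have [s [_ _ sc _] <-] := Hq; have [y ys _] := sc 1 (mul_subgroup1 Hg).
  by case: (s) ys.
have q1q : (q1 < q)%N.
  have [->//|q1_gt0] := posnP q1.
  by apply: leq_trans (dvdn_leq q_gt0 pq1); rewrite ltn_Pmull // prime_gt1.
have [||||d1 Hd1 d1q1] := IH _ q1q K1 iota1 (set_mul H (base_units iota1)) _ _ _ _ Hq1.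
- exact: mul_subgroup_set_mul.
- exact: set_mul_subr.
- move=> _ [y Hy [a K1a <-]]; have [i i_char Ki] := Hrad _ Hy.
  exists i => //; rewrite exprMn; apply: (mul_subgroupM K1g); first exact: K01.
  exact: (mul_subgroupX K1g).
- apply: (no_new_roots_prime_step Hg KH _ Hroots p_pr Hx Pmin Pp Kxp K1E).
  by move=> y /Hrad[i /andP[i_gt0 _] Ki]; exists i.
exists (p * d1)%N; last by apply: dvdn_trans pq1; rewrite dvdn_mul.
rewrite -(adjoin_tower (B := [set x]) K1E) => [|_ -> //].
by apply: has_degree_tower Hd1; rewrite K1E -Pp; apply: adjoin1_degree.
Qed.

(** With [zeta l] written as [h * a], either [a] is in the base field and [zeta l] is in [H], or
    [cyclotomic_radical] yields a nontrivial [l]-power root of unity in the new field. *)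
Lemma no_new_roots_cyclotomic_step (K K1 : fieldType) (iota : {rmorphism K -> L})
    (iota1 : {rmorphism K1 -> L}) (H : set L) z zz :
  mul_subgroup H -> base_units iota `<=` H ->
  (forall h, H h -> exists2 m, (0 < m)%N & base_units iota (h ^+ m)) ->
  z.-primitive_root zz -> range iota1 = adjoin iota [set zz] ->
  no_new_roots iota1 H -> no_new_roots iota1 (set_mul H (base_units iota1)).
Proof.
move=> Hg KH Hrad zzP K1E Hroots l l_pr l_odd l_char Hzl.
have Kg := base_units_subgroup iota; have K1g := base_units_subgroup iota1.
have K1f := range_subfield iota1; have zlP := zetaP l_pr l_char.
have [h [a [k [Hh K1a zE Ka]]]] :=
  set_mul_root_of_unity Hg K1g Kg l_pr Hrad Hzl (prim_expr_order zlP).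
have [K1a' a0] := (base_unitsP _ _).1 K1a; have [Ka' _] := (base_unitsP _ _).1 Ka.
rewrite K1E in K1a'.
have [Kal|[w [K1w wl w1]]] := cyclotomic_radical zzP K1a' Ka'.
  apply: Hroots => //; rewrite zE; apply: (mul_subgroupM Hg) => //.
  by apply/KH/base_unitsP.
by rewrite -K1E in K1w; apply: (subfield_root_of_unity K1f l_pr zlP K1w wl w1).
Qed.

End Kneser.

(** * Reduction to K(zeta_z) *)

Section PrimeProducts.
Variables (s : seq nat) (s_prime : all prime s) (s_uniq : uniq s).
Local Notation z := (\prod_(p <- s) p)%N.

Lemma prime_dvd_prod_primes r : prime r -> (r %| z)%N = (r \in s).
Proof.
move=> r_pr; elim: (s) s_prime => [_|p t IH /= /andP[p_pr t_pr]].
  by rewrite big_nil dvdn1; apply: contraTF r_pr => /eqP ->.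
by rewrite big_cons Euclid_dvdM // dvdn_prime2 // IH // in_cons.
Qed.

(** The product is squarefree: the primes left after removing [r] all differ from [r]. *)
Lemma prime_ndvd_prod_primes_div r : prime r -> (r %| z)%N -> ~~ (r %| z %/ r)%N.
Proof.
move=> r_pr; rewrite prime_dvd_prod_primes // => rs.
rewrite (big_rem r) //= mulKn ?prime_gt0 //.
have rem_pr : all prime (rem r s) by apply/allP=> p /mem_rem/(allP s_prime).
have : r \notin rem r s by rewrite mem_rem_uniqF.
elim: (rem r s) rem_pr.
  by move=> _ _; rewrite big_nil dvdn1; apply: contraTneq r_pr => ->.
move=> p t IH /= /andP[p_pr t_pr]; rewrite in_cons => /norP[rp rt].
by rewrite big_cons Euclid_dvdM // negb_or dvdn_prime2 // rp IH.
Qed.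

End PrimeProducts.

(** If [p] divided [n], then [n %/ p] would do as well: [g ^+ (n %/ p)] has its [p]-th power in the
    base field, and also its [m]-th power for some [m] prime to [p]. *)
Lemma min_exponent_char (K L : fieldType) (iota : {rmorphism K -> L}) (G : set L) n p :
  (forall g, G g -> radical iota g) -> (0 < n)%N ->
  (forall g, G g -> base_units iota (g ^+ n)) ->
  (forall m, (0 < m)%N -> (forall g, G g -> base_units iota (g ^+ m)) -> (n <= m)%N) ->
  p \in [pchar K] -> ~~ (p %| n)%N.
Proof.
move=> Grad n_gt0 nP n_min p_char; apply/negP=> pn.
have p_pr : prime p by case/andP: p_char.
have : (n <= n %/ p)%N; last first.
  by rewrite leqNgt ltn_Pdiv ?prime_gt1.
apply: n_min => [|g Gg]; first by rewrite divn_gt0 ?prime_gt0 // dvdn_leq.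
have [_ [m m_char Km]] := Grad _ Gg.
apply: (mul_subgroup_coprime (base_units_subgroup iota) (prime_gt0 p_pr) (b := m)).
- rewrite prime_coprime //; apply/negP=> /pnat_dvd/(_ m_char).
  by rewrite pnatE // inE /= p_char.
- by rewrite -exprM divnK //; apply: nP.
by rewrite exprAC; apply: mul_subgroupX => //; apply: base_units_subgroup.
Qed.

Theorem theorem1p2 (K : fieldType) (Kbar : closedFieldType)
    (iota : {rmorphism K -> Kbar})
    (Kbar_algebraic : forall x : Kbar, algebraicOver iota x)
    (zeta : nat -> Kbar) (zetaP : coherent_roots_of_unity K zeta)
    (G : set Kbar) (G_subgroup : mul_subgroup G)
    (G_radicals : forall g, G g -> radical iota g)
    (index_finite :
       finite_set (cosets (set_mul G (base_units iota)) (base_units iota)))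
    (n : nat) (n_gt0 : (0 < n)%N)
    (nP : forall g, G g -> base_units iota (g ^+ n))
    (n_min : forall m : nat, (0 < m)%N ->
       (forall g, G g -> base_units iota (g ^+ m)) -> (n <= m)%N)
    (z : nat)
    (z_def : z = (\prod_(p <- primes n |
        [&& odd p, `[< ~ base_units iota (zeta p) >]
          & `[< set_mul G (base_units iota) (zeta p) >]]) p)%N) :
  let q := mul_index (set_mul G (base_units iota)) (base_units iota) in
  exists d dz : nat,
    [/\ has_degree iota (adjoin iota G) d,
        has_degree iota (adjoin iota [set zeta z]) dz,
        (z %| dz * q)%N
      & (d %| (dz * q) %/ z)%N].
Proof.
set H := set_mul G (base_units iota) in z_def index_finite *; move=> q.
have [zeta_prim zeta_coh] := zetaP.
have Kg := base_units_subgroup iota; have Kf := range_subfield iota.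
have Hg : mul_subgroup H by apply: mul_subgroup_set_mul.
have KH : base_units iota `<=` H by apply: set_mul_subr.
have Hq : has_index H (base_units iota) q by apply: has_index_mul_index.
have charE : [pchar Kbar]^' =i [pchar K]^'.
  by apply: eq_negn => p; rewrite (fmorph_pchar iota).
have Hrad h : H h -> exists2 m, [pchar Kbar]^'.-nat m & base_units iota (h ^+ m).
  move=> [g Gg [a Ka <-]]; have [_ [m m_char Km]] := G_radicals _ Gg.
  exists m; first by rewrite (eq_pnat _ charE).
  by rewrite exprMn; apply: (mul_subgroupM Kg) => //; apply: (mul_subgroupX Kg).
have Hrad0 h : H h -> exists2 m, (0 < m)%N & base_units iota (h ^+ m).
  by move=> /Hrad[m /andP[m_gt0 _] Km]; exists m.
have HnP h : H h -> base_units iota (h ^+ n).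
  move=> [g Gg [a Ka <-]]; rewrite exprMn; apply: (mul_subgroupM Kg); first exact: nP.
  exact: (mul_subgroupX Kg).
have zetaP' l : prime l -> l \notin [pchar Kbar] -> l.-primitive_root (zeta l).
  by move=> l_pr l_char; apply: zeta_prim; rewrite -(eq_pnat _ charE) pnatE.
pose cond p := [&& odd p, `[< ~ base_units iota (zeta p) >] & `[< H (zeta p) >]].
pose s := [seq p <- primes n | cond p].
have zE : z = (\prod_(p <- s) p)%N by rewrite z_def /s big_filter.
have s_pr : all prime s.
  by apply/allP=> p; rewrite mem_filter mem_primes => /and3P[_].
have s_uniq : uniq s by rewrite filter_uniq // primes_uniq.
have zs r : prime r -> (r %| z)%N = (r \in s).
  by move=> r_pr; rewrite zE prime_dvd_prod_primes.
have z_gt0 : (0 < z)%N.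
  by rewrite zE big_seq prodn_cond_gt0 // => p /(allP s_pr)/prime_gt0.
have zK : [pchar K]^'.-nat z.
  apply/pnatP=> // r r_pr; rewrite zs // mem_filter mem_primes => /and4P[_ _ _ rn].
  by apply/negP=> /(min_exponent_char G_radicals n_gt0 nP n_min); rewrite rn.
have zzP := zeta_prim _ zK.
have dvdK r : (r %| z)%N -> [pchar K]^'.-nat r by move=> /pnat_dvd; apply.
have zeta_z r : prime r -> (r %| z)%N -> zeta z ^+ (z %/ r) = zeta r.
  by move=> r_pr rz; apply: zeta_coh => //; apply: dvdK.
have Kz : base_units iota (zeta z ^+ z).
  by rewrite (prim_expr_order zzP); apply: mul_subgroup1.
(* The order of [zeta z] modulo the base field is [z]: if it were a proper divisor,
   [zeta z ^+ (z %/ r)], that is [zeta r], would be in the base field for some prime [r] dividing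
   [z]. *)
have zP j : base_units iota (zeta z ^+ j) <-> (z %| j)%N.
  have [o o_gt0 oP] := order_mod Kg z_gt0 Kz; rewrite oP.
  have oz : (o %| z)%N by apply/oP.
  suff -> : o = z by [].
  apply/eqP; case: eqP => // /eqP o_neq.
  have zo_gt1 : (1 < z %/ o)%N.
    rewrite ltn_neqAle divn_gt0 // dvdn_leq // andbT eq_sym.
    by apply: contra o_neq => /eqP zo; rewrite -(divnK oz) zo mul1n.
  have r_pr := pdiv_prime zo_gt1; set r := pdiv _ in r_pr.
  have r_dvd : (r %| z %/ o)%N by apply: pdiv_dvd.
  have rz : (r %| z)%N by apply: dvdn_trans r_dvd (dvdn_div oz).
  move: (rz); rewrite zs // mem_filter => /andP[/and3P[_ /asboolP nKr _] _].
  case: nKr; rewrite -zeta_z //; apply/oP.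
  by rewrite dvdn_divRL // mulnC -dvdn_divRL.
(* If a prime [r] divided the order [o] of [zeta z] modulo [H], then [zeta r] being in [H] would
   make [o], and hence [r], divide [z %/ r]. *)
have Hz : H (zeta z).
  have [o o_gt0 oP] := order_mod Hg z_gt0 (KH _ Kz).
  have oz : (o %| z)%N by apply/oP/KH.
  rewrite -[zeta z]expr1; apply/oP; rewrite dvdn1; apply/negPn/negP=> o1.
  have r_pr : prime (pdiv o) by rewrite pdiv_prime // ltn_neqAle eq_sym o1.
  set r := pdiv o in r_pr; have ro : (r %| o)%N by apply: pdiv_dvd.
  have rz := dvdn_trans ro oz.
  have /negP[] : ~~ (r %| z %/ r)%N by rewrite zE prime_ndvd_prod_primes_div // -zE.
  apply: dvdn_trans ro _; apply/oP; rewrite zeta_z //.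
  by move: rz; rewrite zs // mem_filter => /andP[/and3P[_ _ /asboolP]].
have [P Pmin] := minpoly_exists (Kbar_algebraic (zeta z)).
have Kzdeg := adjoin1_degree Pmin; set dz := (size P).-1 in Kzdeg.
have [K1 [iota1 K1E]] := subfield_as_field (adjoin_subfield iota [set zeta z]).
have K1g := base_units_subgroup iota1; have K1f := range_subfield iota1.
have K01 : base_units iota `<=` base_units iota1.
  move=> y /base_unitsP[Ky y0]; apply/base_unitsP; split=> //.
  by rewrite K1E; apply: range_sub_adjoin.
have K1z : range iota1 (zeta z) by rewrite K1E; apply: sub_adjoin.
have K1zu : base_units iota1 (zeta z).
  by apply/base_unitsP; split=> //; apply: mul_subgroup_neq0 Hz.
have [q1 [Hq1 zq1]] := has_index_base_change Hg Kg K1g KH K01 Hq Hz K1zu z_gt0 zP.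
(* If [zeta l] is in [H] but not in the base field, then [l] divides [n], as otherwise its powers
   [l] and [n] would be coprime exponents into the base field. So [l] divides [z], and [zeta l] is a
   power of [zeta z]. *)
have Hroots : no_new_roots zeta iota1 H.
  move=> l l_pr l_odd l_char Hl.
  have [Kl|nKl] := pselect (base_units iota (zeta l)).
    by have /base_unitsP[] := K01 _ Kl.
  have ln : (l %| n)%N.
    apply: contra_notT nKl => nln.
    apply: (mul_subgroup_coprime Kg (prime_gt0 l_pr) (b := n)); last exact: HnP.
      by rewrite prime_coprime.
    by rewrite (prim_expr_order (zetaP' _ l_pr l_char)); apply: mul_subgroup1.
  have lz : (l %| z)%N.
    rewrite zs // mem_filter mem_primes l_pr n_gt0 ln /cond l_odd /= andbT.
    by apply/andP; split; apply/asboolP.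
  by rewrite -zeta_z //; apply: (subfieldX K1f).
have [||||d1 Hd1 d1q1] := degree_dvd_index zetaP' (iota := iota1) _ _ _ _ Hq1.
- exact: mul_subgroup_set_mul.
- exact: set_mul_subr.
- move=> _ [y Hy [a K1a <-]]; have [i i_char Ki] := Hrad _ Hy.
  exists i => //; rewrite exprMn; apply: (mul_subgroupM K1g); first exact: K01.
  exact: (mul_subgroupX K1g).
- exact: (no_new_roots_cyclotomic_step zetaP' Hg KH Hrad0 zzP K1E Hroots).
have GH : adjoin iota1 (set_mul H (base_units iota1)) = adjoin iota G.
  rewrite (adjoin_tower (B := [set zeta z]) K1E) => [|_ -> //].
  have Gf := adjoin_subfield iota G.
  apply/seteqP; split; apply: adjoin_min => //; try exact: range_sub_adjoin.
  - move=> _ [g Gg [a /base_unitsP[Ka _] <-]].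
    by apply: (subfieldM Gf); [apply: sub_adjoin | apply: range_sub_adjoin].
  - exact: adjoin_subfield.
  by apply: subset_trans (@sub_adjoin _ _ _ _); apply: set_mul_subl.
rewrite GH in Hd1; rewrite -K1E in Kzdeg *.
have zq : (z %| q)%N by apply: dvdn_trans zq1; rewrite dvdn_mulr.
(* The tower law gives [dz * d1], where [d1] divides [q1] and [q1] divides [q %/ z]. *)
exists (dz * d1)%N, dz; split=> //.
- exact: has_degree_tower Kzdeg Hd1.
- by rewrite dvdn_mull.
rewrite -muln_divA // dvdn_mul //; apply: dvdn_trans d1q1 _.
by rewrite dvdn_divRL // mulnC.
Qed.
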